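(* Let $a_n$ ($n\ge1$) be the coefficients in the expansion $W(e^t)=\omega_0+\sum_{n=1}^\infty a_nt^n$ about $t=0$. Then $$a_n=\frac{\omega_0}{n!}\sum_{k=0}^{n-1}\frac{(-1)^{n+k-1}\,d(n+k-1,k)}{(1+\omega_0)^{n+k}}.$$
   Context: $W$ is the principal branch of the Lambert $W$ function and $\omega_0=W(1)$. $d(m,k)$ are the unsigned associated Stirling numbers of the first kind, given by $$[\ln(1+v)-v]^k=k!\sum_{m=2k}^\infty(-1)^{m+k}d(m,k)\frac{v^m}{m!}$$ (with $d(m,k)=0$ for $0\le m<2k$). *)

(* Defs.v *)
From Stdlib Require Import Reals Factorial ClassicalEpsilon.
From Coquelicot Require Import Coquelicot.
Local Open Scope R_scope.

Definition Cexp (z : C) : C := (exp (Re z) * cos (Im z), exp (Re z) * sin (Im z)).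

(* Range of the principal branch of the Lambert W function (Corless, Gonnet,
   Hare, Jeffrey and Knuth, 1996): the points xi + i eta with -pi < eta < pi
   lying to the right of the curve xi = - eta cot eta, which meets the real
   axis at -1.  The half of the curve with eta >= 0 is included: it is the
   image of the branch cut (-oo, -1/e], on which W is continuous from above.
   The map w |-> w e^w is a bijection from this set onto C. *)
Definition W_range (w : C) : Prop :=
  (Im w = 0 /\ -1 <= Re w) \/
  (0 < Im w < PI /\ - Im w * (cos (Im w) / sin (Im w)) <= Re w) \/
  (- PI < Im w < 0 /\ - Im w * (cos (Im w) / sin (Im w)) < Re w).

Definition LambertW (z : C) : C :=
  epsilon (inhabits (RtoC 0)) (fun w => W_range w /\ (w * Cexp w)%C = z).

Definition omega0 : C := LambertW (RtoC 1).

(* The second clause is the generating function identity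
     [ln(1+v) - v]^k = k! sum_{m >= 2k} (-1)^(m+k) d(m,k) v^m / m!
   for v near 0, with the summation index shifted to m = 2k + j, j >= 0. *)
Definition assoc_stirling1 (d : nat -> nat -> R) : Prop :=
  (forall m k : nat, (m < 2 * k)%nat -> d m k = 0) /\
  (forall k : nat, exists r : R, 0 < r /\
    forall v : R, Rabs v < r ->
      exists s : R,
        is_series
          (fun j : nat => (-1) ^ (2 * k + j + k) * d (2 * k + j)%nat k
             * (v ^ (2 * k + j) / INR (fact (2 * k + j)))) s /\
        (ln (1 + v) - v) ^ k = INR (fact k) * s).

(* W(e^t) = omega0 + sum_{n >= 1} a_n t^n for all complex t near 0; the value
   a 0 plays no role. *)
Definition W_exp_expansion (a : nat -> C) : Prop :=
  exists r : R, 0 < r /\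
    forall t : C, Cmod t < r ->
      exists s : C,
        is_series (fun j : nat => (a (S j) * t ^ S j)%C) s /\
        LambertW (Cexp t) = (omega0 + s)%C.

(* Main.v *)
Require Import Defs.
From Stdlib Require Import Reals Factorial Lra Lia ClassicalEpsilon.
From Coquelicot Require Import Coquelicot.
Open Scope R_scope.

(** The coefficients a_n are determined by the values of W(e^t) at real t alone,
    where W(e^t) is real: w = W(e^t) is positive and w e^w = e^t. A series that
    converges to a real function on a real interval has real coefficients, so
    w is the sum of a real power series. It is therefore differentiable, and
    differentiating w e^w = e^t gives the autonomous equation w' = w / (1 + w)
    ([is_derive_realW]).

    Iterating this equation gives, for n >= 0 and near t = 0,
<<
      w^(n+1) = sum_{k <= n} (-1)^(n+k) d(n+k,k) w / (1 + w)^(n+1+k)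
>>
    ([Derive_n_realW]). Indeed one application of (w / (1 + w)) d/dw to
    w / (1 + w)^p produces p w / (1 + w)^(p+2) - (p-1) w / (1 + w)^(p+1), so the
    coefficients of consecutive derivatives are linked by a two-term recurrence.
    It is the one satisfied by the associated Stirling numbers,
<<
      d(m+2,k+1) = (m+1) (d(m+1,k+1) + d(m,k)),
>>
    which is the comparison of coefficients in (1 + v) F_{k+1}' = - v F_k for
    F_k = (ln(1+v) - v)^k / k! ([stirling_rec]). The theorem is the case t = 0,
    after division by (n+1)!. *)

(** * Real power series *)

(** Convergence at some y strictly between |x| and r makes the terms at y tend
    to 0, which is impossible beyond the radius of convergence. *)
Lemma CV_radius_gt_of_disk (a : nat -> R) (r : R) :
  (forall x, Rabs x < r -> ex_series (fun n => a n * x ^ n)) ->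
  forall x, Rabs x < r -> Rbar_lt (Rabs x) (CV_radius a).
Proof.
  intros Hconv x Hx.
  apply Rbar_not_le_lt; intros Hle.
  set (y := (Rabs x + r) / 2).
  assert (Hx0 := Rabs_pos x).
  assert (Hy : Rabs y = y) by (apply Rabs_pos_eq; unfold y; lra).
  apply (CV_disk_outside a y).
  - apply (Rbar_le_lt_trans _ _ _ Hle); simpl; rewrite Hy; unfold y; lra.
  - apply ex_series_lim_0, Hconv; rewrite Hy; unfold y; lra.
Qed.

Lemma locally_0_Rabs (r : R) (P : R -> Prop) :
  0 < r -> (forall x, Rabs x < r -> P x) -> locally 0 P.
Proof.
  intros Hr HP; exists (mkposreal r Hr); intros x Hx; apply HP.
  replace x with (x - 0) by ring; exact Hx.
Qed.

Lemma Rabs_lt_locally (r x : R) : Rabs x < r -> locally x (fun y => Rabs y < r).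
Proof.
  intros Hx. assert (Hd : 0 < r - Rabs x) by lra.
  exists (mkposreal _ Hd); intros y Hy.
  change (Rabs (y - x) < r - Rabs x) in Hy.
  replace y with ((y - x) + x) by ring.
  generalize (Rabs_triang (y - x) x); lra.
Qed.

Lemma PSeries_locally_zero (a : nat -> R) (r : R) :
  0 < r -> Rbar_lt 0 (CV_radius a) ->
  (forall x, Rabs x < r -> PSeries a x = 0) -> forall n, a n = 0.
Proof.
  intros Hr Hcv H0 n.
  apply (PSeries_ext_recip a (fun _ => 0)); auto.
  - rewrite CV_radius_const_0; exact I.
  - apply (locally_0_Rabs r); auto; intros x Hx.
    rewrite PSeries_const_0; auto.
Qed.

(** * Sums and series of complex numbers *)

Lemma sum_n_Re (u : nat -> C) (n : nat) :
  Re (sum_n u n) = sum_n (fun k => Re (u k)) n.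
Proof.
  induction n as [|n IH]; [now rewrite !sum_O|].
  rewrite !sum_Sn, <- IH; reflexivity.
Qed.

Lemma sum_n_Im (u : nat -> C) (n : nat) :
  Im (sum_n u n) = sum_n (fun k => Im (u k)) n.
Proof.
  induction n as [|n IH]; [now rewrite !sum_O|].
  rewrite !sum_Sn, <- IH; reflexivity.
Qed.

Lemma sum_n_RtoC (u : nat -> R) (n : nat) :
  sum_n (fun k => RtoC (u k)) n = RtoC (sum_n u n).
Proof.
  induction n as [|n IH]; [now rewrite !sum_O|].
  rewrite !sum_Sn, IH; symmetry; apply RtoC_plus.
Qed.

Lemma is_series_Re (u : nat -> C) (s : C) :
  is_series u s -> is_series (fun n => Re (u n)) (Re s).
Proof.
  intros H.
  apply filterlim_ext with (fun n => Re (sum_n u n)).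
  { intros n; apply sum_n_Re. }
  apply filterlim_comp with (1 := H).
  apply (continuous_fst (fst s) (snd s)).
Qed.

Lemma is_series_Im (u : nat -> C) (s : C) :
  is_series u s -> is_series (fun n => Im (u n)) (Im s).
Proof.
  intros H.
  apply filterlim_ext with (fun n => Im (sum_n u n)).
  { intros n; apply sum_n_Im. }
  apply filterlim_comp with (1 := H).
  apply (continuous_snd (fst s) (snd s)).
Qed.

(** * The Lambert function on the positive reals *)

Lemma mul_exp_surjective (y : R) : 0 < y -> exists x, 0 < x /\ x * exp x = y.
Proof.
  intros Hy.
  destruct (IVT (fun x => x * exp x - y) 0 y) as [x [Hx Hroot]].
  - intros x; apply continuity_pt_filterlim.
    apply (ex_derive_continuous (fun x => x * exp x - y)); auto_derive; auto.
  - exact Hy.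
  - lra.
  - generalize (exp_ineq1 y); nra.
  - exists x; split; [|lra].
    destruct (Req_dec x 0) as [->|Hn]; lra.
Qed.

(** For w = u + i v with v <> 0, the product w e^w is real only if
    u = - v cot v, so w lies on the boundary curve of the range. The lower half
    of that curve does not belong to the range, and on the upper half
    w e^w = - e^u v / sin v is negative. *)
Lemma W_range_real (w : C) (y : R) :
  0 < y -> W_range w -> (w * Cexp w)%C = RtoC y ->
  Im w = 0 /\ 0 < Re w /\ Re w * exp (Re w) = y.
Proof.
  intros Hy Hrange Heq.
  destruct w as [u v].
  injection Heq as Hre Him; simpl in *.
  unfold W_range in Hrange; simpl in Hrange.
  assert (He := exp_pos u).
  destruct Hrange as [[-> _]|Hcurve].
  - rewrite cos_0, sin_0 in Hre. split; [reflexivity|].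
    assert (u * exp u = y) by lra. split; [|assumption].
    nra.
  - exfalso.
    assert (Hs : sin v <> 0).
    { destruct Hcurve as [[[? ?] _]|[[? ?] _]].
      - apply Rgt_not_eq, sin_gt_0; lra.
      - apply Rlt_not_eq, sin_lt_0_var; lra. }
    assert (Hi : u * sin v + v * cos v = 0) by nra.
    assert (Hu : u = - v * (cos v / sin v)).
    { apply (Rmult_eq_reg_r (sin v)); [|exact Hs]. field_simplify; lra. }
    destruct Hcurve as [[[Hv HvPI] _]|[_ Hlt]]; [|lra].
    assert (Hsp : 0 < sin v) by (apply sin_gt_0; lra).
    assert (H1 : y * sin v = - exp u * v).
    { rewrite <- Hre.
      replace ((u * (exp u * cos v) - v * (exp u * sin v)) * sin v)
        with (exp u * ((u * sin v + v * cos v) * cos v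
                       - v * (Rsqr (sin v) + Rsqr (cos v))))
        by (unfold Rsqr; ring).
      rewrite Hi, sin2_cos2; ring. }
    nra.
Qed.

(** Any value selected from the range for a positive y is real and positive;
    the real root of x e^x = y shows that there is one to select. *)
Lemma LambertW_pos (y : R) :
  0 < y -> Im (LambertW (RtoC y)) = 0 /\ 0 < Re (LambertW (RtoC y)) /\
    Re (LambertW (RtoC y)) * exp (Re (LambertW (RtoC y))) = y.
Proof.
  intros Hy.
  assert (Hspec : W_range (LambertW (RtoC y)) /\
            (LambertW (RtoC y) * Cexp (LambertW (RtoC y)))%C = RtoC y).
  { unfold LambertW; apply epsilon_spec.
    destruct (mul_exp_surjective y Hy) as [x [Hx Hxy]].
    exists (RtoC x); split.
    - left; simpl; lra.
    - unfold Cexp; simpl. rewrite cos_0, sin_0.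
      apply injective_projections; simpl; lra. }
  apply W_range_real; tauto.
Qed.

Lemma Cexp_RtoC (t : R) : Cexp (RtoC t) = RtoC (exp t).
Proof.
  unfold Cexp; simpl; rewrite cos_0, sin_0.
  apply injective_projections; simpl; ring.
Qed.

Definition realW (t : R) : R := Re (LambertW (Cexp (RtoC t))).

Lemma realW_spec (t : R) :
  LambertW (Cexp (RtoC t)) = RtoC (realW t) /\
  0 < realW t /\ realW t * exp (realW t) = exp t.
Proof.
  unfold realW; rewrite Cexp_RtoC.
  destruct (LambertW_pos (exp t) (exp_pos t)) as [Him [Hpos Heq]].
  split; [|tauto].
  apply injective_projections; [reflexivity | exact Him].
Qed.

Lemma omega0_realW : omega0 = RtoC (realW 0).
Proof.
  rewrite <- (proj1 (realW_spec 0)), Cexp_RtoC, exp_0; reflexivity.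
Qed.

(** Implicit differentiation of w e^w = e^t: since w e^w is again e^t, the
    exponential cancels. *)
Lemma is_derive_realW (t : R) :
  ex_derive realW t -> is_derive realW t (realW t / (1 + realW t)).
Proof.
  intros Hex.
  destruct (realW_spec t) as [_ [Hpos Heq]].
  assert (H1 : is_derive (fun x => realW x * exp (realW x)) t
                 (Derive realW t * (1 + realW t) * exp (realW t))).
  { auto_derive; [tauto|]. rewrite Rmult_1_l. 
    change (Derive (fun x => realW x) t) with (Derive realW t). ring. }
  assert (H2 : is_derive (fun x => realW x * exp (realW x)) t (exp t)).
  { apply is_derive_ext with exp; [intros x; symmetry; apply realW_spec|].
    apply is_derive_Reals, derivable_pt_lim_exp. }
  apply is_derive_unique in H1; apply is_derive_unique in H2.
  assert (He := exp_pos (realW t)).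
  replace (realW t / (1 + realW t)) with (Derive realW t).
  { apply Derive_correct, Hex. }
  rewrite H1, <- Heq in H2.
  apply Rmult_eq_reg_r in H2; [|lra].
  apply (Rmult_eq_reg_r (1 + realW t)); [|lra].
  rewrite H2; field; lra.
Qed.


(** * The associated Stirling numbers *)

(** The coefficient of v^m in (ln(1+v) - v)^k / k!. *)
Definition stirling_coef (d : nat -> nat -> R) (k m : nat) : R :=
  (-1) ^ (m + k) * d m k / INR (fact m).

(** Since d(m,k) = 0 for m < 2k, the defining series indexed by m = 2k + j is an
    ordinary power series in v. *)
Lemma stirling_gf (d : nat -> nat -> R) (k : nat) :
  assoc_stirling1 d ->
  exists r, 0 < r /\ forall v, Rabs v < r ->
  is_series (fun m => stirling_coef d k m * v ^ m)
    ((ln (1 + v) - v) ^ k / INR (fact k)).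
Proof.
  intros [Hzero Hgf].
  destruct (Hgf k) as [r [Hr Hser]].
  exists r; split; [exact Hr|]; intros v Hv.
  destruct (Hser v Hv) as [s [Hs ->]].
  replace (INR (fact k) * s / INR (fact k)) with s
    by (field; apply INR_fact_neq_0).
  assert (Hshift : is_series
     (fun j => stirling_coef d k (2 * k + j) * v ^ (2 * k + j)) s).
  { apply is_series_ext with (2 := Hs); intros j; unfold stirling_coef.
    unfold Rdiv; ring_simplify; reflexivity. }
  destruct k as [|k]; [exact Hshift|].
  apply is_series_decr_n with (2 * S k)%nat; [lia|].
  rewrite (sum_n_ext_loc _ (fun _ => 0)), sum_n_const, Rmult_0_r.
  - change (is_series (fun j => stirling_coef d (S k) (2 * S k + j)
                                * v ^ (2 * S k + j)) (s + - 0)).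
    rewrite Ropp_0, Rplus_0_r; exact Hshift.
  - intros m Hm; unfold stirling_coef; rewrite Hzero by lia.
    unfold Rdiv; rewrite Rmult_0_r, !Rmult_0_l; reflexivity.
Qed.

(** The bound r <= 1 keeps 1 + v positive, so that ln(1 + v) is
    differentiable on the interval. *)
Lemma stirling_PSeries (d : nat -> nat -> R) (k : nat) :
  assoc_stirling1 d ->
  exists r, 0 < r <= 1 /\ forall v, Rabs v < r ->
  Rbar_lt (Rabs v) (CV_radius (stirling_coef d k)) /\
  PSeries (stirling_coef d k) v = (ln (1 + v) - v) ^ k / INR (fact k).
Proof.
  intros Hd.
  destruct (stirling_gf d k Hd) as [r [Hr Hser]].
  exists (Rmin r 1); split.
  { split; [apply Rmin_glb_lt; lra | apply Rmin_r]. }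
  intros v Hv.
  assert (Hvr : Rabs v < r) by (generalize (Rmin_l r 1); lra).
  split.
  - apply (CV_radius_gt_of_disk _ r); [|exact Hvr].
    intros x Hx; eexists; apply Hser, Hx.
  - apply is_series_unique, Hser, Hvr.
Qed.

Lemma PSeries_derive_loc (a : nat -> R) (f : R -> R) (r v l : R) :
  (forall x, Rabs x < r -> Rbar_lt (Rabs x) (CV_radius a) /\ PSeries a x = f x) ->
  Rabs v < r -> is_derive f v l -> PSeries (PS_derive a) v = l.
Proof.
  intros Hf Hv Hl.
  rewrite <- (is_derive_unique _ _ _ Hl).
  symmetry; apply is_derive_unique.
  apply is_derive_ext_loc with (PSeries a).
  - apply filter_imp with (2 := Rabs_lt_locally r v Hv); intros y Hy; apply Hf, Hy.
  - apply is_derive_PSeries, Hf, Hv.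
Qed.

(** For k = 0 the generating function is the constant 1: its value at 0 gives
    d(0,0), and its zero derivative gives the other numbers. *)
Lemma stirling_n_0 (d : nat -> nat -> R) (m : nat) :
  assoc_stirling1 d -> d m 0%nat = match m with O => 1 | S _ => 0 end.
Proof.
  intros Hd.
  destruct (stirling_PSeries d 0 Hd) as [r [[Hr _] Hcv]].
  assert (H0 : Rabs 0 < r) by (rewrite Rabs_R0; exact Hr).
  destruct m as [|m].
  - destruct (Hcv 0 H0) as [_ H]; rewrite PSeries_0 in H.
    unfold stirling_coef in H; simpl in H; lra.
  - assert (H : PS_derive (stirling_coef d 0) m = 0).
    { apply (PSeries_locally_zero _ r); [exact Hr| |].
      - rewrite CV_radius_derive, <- Rabs_R0; apply Hcv, H0.
      - intros v Hv; apply (PSeries_derive_loc _ _ _ _ _ Hcv Hv).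
        simpl; auto_derive; auto. }
    unfold PS_derive, stirling_coef in H.
    assert (Hf := INR_fact_neq_0 (S m)).
    assert (Hm := not_0_INR (S m) (Nat.neq_succ_0 m)).
    assert (Hp := pow_nonzero (-1) (S m + 0) ltac:(lra)).
    unfold Rdiv in H.
    apply Rmult_integral in H as [H|H]; [contradiction|].
    apply Rmult_integral in H as [H|H].
    + apply Rmult_integral in H as [H|H]; [contradiction|exact H].
    + exfalso; revert H; apply Rinv_neq_0_compat, Hf.
Qed.

(** This is the coefficient of v^(m+1) in (1 + v) F_{k+1}' + v F_k = 0, where
    F_k = (ln(1+v) - v)^k / k!. The equation holds because the derivative of
    ln(1+v) - v is - v / (1 + v). *)
Lemma stirling_rec (d : nat -> nat -> R) (m k : nat) :
  assoc_stirling1 d ->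
  d (S (S m)) (S k) = INR (S m) * (d (S m) (S k) + d m k).
Proof.
  intros Hd.
  destruct (stirling_PSeries d k Hd) as [r0 [[Hr0 Hr01] Hcv0]].
  destruct (stirling_PSeries d (S k) Hd) as [r1 [[Hr1 _] Hcv1]].
  set (c0 := stirling_coef d k) in *.
  set (c1 := PS_derive (stirling_coef d (S k))).
  set (r := Rmin r0 r1).
  assert (Hr : 0 < r) by (apply Rmin_glb_lt; assumption).
  assert (Hle0 : r <= r0) by apply Rmin_l.
  assert (Hle1 : r <= r1) by apply Rmin_r.
  assert (Hcvr : forall v, Rabs v < r ->
    Rbar_lt (Rabs v) (CV_radius c0) /\ Rbar_lt (Rabs v) (CV_radius c1)).
  { intros v Hv; unfold c1; rewrite CV_radius_derive.
    split; [apply Hcv0 | apply Hcv1]; lra. }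
  assert (Hex : forall v, Rabs v < r -> ex_pseries c1 v /\
     ex_pseries (PS_incr_1 (PS_plus c1 c0)) v /\ ex_pseries c0 v).
  { intros v Hv; destruct (Hcvr v Hv).
    repeat split; try (apply CV_radius_inside; assumption).
    apply ex_pseries_incr_1, ex_pseries_plus; apply CV_radius_inside; assumption. }
  (* The equation is used in the form F' + v (F' + F_k) = 0 with F = F_{k+1}. *)
  assert (Hode : PS_plus c1 (PS_incr_1 (PS_plus c1 c0)) (S m) = 0).
  { apply (PSeries_locally_zero _ r); [exact Hr| |].
    - rewrite <- Rabs_R0; apply (CV_radius_gt_of_disk _ r).
      + intros v Hv; apply ex_pseries_R, ex_pseries_plus; apply Hex, Hv.
      + rewrite Rabs_R0; exact Hr.
    - intros v Hv; destruct (Hex v Hv) as [He1 [Hei He0]].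
      rewrite PSeries_plus, PSeries_incr_1, PSeries_plus by assumption.
      assert (Hv1 : -1 < v) by (apply Rabs_def2 in Hv; lra).
      assert (Hder : PSeries c1 v
                = - v / (1 + v) * ((ln (1 + v) - v) ^ k / INR (fact k))).
      { apply (PSeries_derive_loc _ _ r1 _ _ Hcv1); [lra|].
        auto_derive; [lra|].
        change (fact k + k * fact k)%nat with (fact (S k)).
        change (match k with O => 1 | S _ => INR k + 1 end) with (INR (S k)).
        rewrite fact_simpl, mult_INR; fold (ln (1 + v) - v).
        field; repeat split; try lra.
        - apply INR_fact_neq_0.
        - apply not_0_INR; lia. }
      rewrite Hder; replace (PSeries c0 v) with ((ln (1 + v) - v) ^ k / INR (fact k))
        by (symmetry; apply Hcv0; lra).
      field; split; [apply INR_fact_neq_0 | lra]. }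
  unfold PS_plus, PS_incr_1, c1, c0, PS_derive in Hode.
  change (INR (S (S m)) * stirling_coef d (S k) (S (S m))
    + (INR (S m) * stirling_coef d (S k) (S m) + stirling_coef d k m) = 0) in Hode.
  unfold stirling_coef in Hode.
  rewrite !fact_simpl, !mult_INR, !pow_add in Hode.
  rewrite <- !tech_pow_Rmult in Hode.
  assert (Hfm := INR_fact_neq_0 m).
  assert (Hm1 := not_0_INR (S m) (Nat.neq_succ_0 m)).
  assert (Hm2 := not_0_INR (S (S m)) (Nat.neq_succ_0 (S m))).
  assert (Hpm := pow_nonzero (-1) m ltac:(lra)).
  assert (Hpk := pow_nonzero (-1) k ltac:(lra)).
  (* Multiplied by this constant, the difference of the two sides is minus the
     left side of Hode. *)
  apply (Rmult_eq_reg_l ((-1) ^ m * (-1) ^ k / (INR (S m) * INR (fact m)))).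
  - apply Rminus_diag_uniq; rewrite <- Ropp_0, <- Hode; field; tauto.
  - unfold Rdiv; repeat apply Rmult_integral_contrapositive_currified;
      try apply Rinv_neq_0_compat; try assumption.
    apply Rmult_integral_contrapositive_currified; assumption.
Qed.

(** * Iterated derivatives of W(e^t) *)

Lemma sum_n_succ (u : nat -> R) (n : nat) : sum_n u (S n) = sum_n u n + u (S n).
Proof. rewrite sum_Sn; reflexivity. Qed.

Lemma sum_n_Rmult_l (c : R) (u : nat -> R) (n : nat) :
  sum_n (fun k => c * u k) n = c * sum_n u n.
Proof. exact (sum_n_mult_l (K := R_Ring) c u n). Qed.

Definition lambert_summand (d : nat -> nat -> R) (n k : nat) (x : R) : R :=
  (-1) ^ (n + k) * d (n + k)%nat k * (x / (1 + x) ^ (n + 1 + k)).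

(** With q = p + 1, the numerator 1 + x - q x is written as q - (q - 1)(1 + x), so
    that multiplication by x / (1 + x) gives functions of the form x / (1 + x)^j
    again. *)
Lemma is_derive_div_pow (x : R) (p : nat) :
  0 < x -> is_derive (fun y => y / (1 + y) ^ S p) x
    ((INR (S p) / (1 + x) ^ (S (S p)) - INR p / (1 + x) ^ S p)).
Proof.
  intros Hx.
  assert (Hp : (1 + x) ^ p <> 0) by (apply pow_nonzero; lra).
  auto_derive.
  - apply Rmult_integral_contrapositive_currified; [lra | exact Hp].
  - change (match p with O => 1 | S _ => INR p + 1 end) with (INR (S p)).
    rewrite <- !tech_pow_Rmult, S_INR. simpl Init.Nat.pred.
    field; split; [exact Hp | lra].
Qed.

(** The left side is the derivative of the sum for n along w' = w / (1 + w),
    evaluated at w = x. Each of its terms contributes to two neighbouring powers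
    of 1 / (1 + x), and the Stirling recurrence collects these contributions. *)
Lemma lambert_sum_step (d : nat -> nat -> R) (n : nat) (x : R) :
  assoc_stirling1 d -> 0 < x ->
  sum_n (fun k => (-1) ^ (n + k) * d (n + k)%nat k *
     (INR (S (n + k)) / (1 + x) ^ (S (S (n + k)))
       - INR (n + k) / (1 + x) ^ S (n + k))) n * (x / (1 + x))
  = sum_n (fun k => lambert_summand d (S n) k x) (S n).
Proof.
  intros Hd Hx.
  set (T := fun k => _).
  (* Truncated at N, the two sides differ by the contribution of the term N to
     the next power, which the coefficient for N + 1 would absorb. *)
  assert (Htel : forall N, sum_n T N * (x / (1 + x))
     = sum_n (fun k => lambert_summand d (S n) k x) N
       + (-1) ^ (n + N) * d (n + N)%nat N
         * (INR (S (n + N)) * x / (1 + x) ^ (n + N + 3))).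
  { intros N; induction N as [|N IH].
    - rewrite !sum_O; unfold T, lambert_summand.
      rewrite !Nat.add_0_r, !stirling_n_0 by exact Hd.
      destruct n as [|n]; simpl; [field; lra | unfold Rdiv; ring].
    - rewrite !sum_n_succ, Rmult_plus_distr_r, IH.
      unfold T, lambert_summand.
      replace (n + S N)%nat with (S (n + N)) by lia.
      replace (S n + S N)%nat with (S (S (n + N))) by lia.
      replace (S n + 1 + S N)%nat with (n + N + 3)%nat by lia.
      rewrite stirling_rec by exact Hd.
      rewrite (S_INR (S (n + N))), !pow_add, <- !tech_pow_Rmult.
      assert (Hn := pow_nonzero (1 + x) n ltac:(lra)).
      assert (HN := pow_nonzero (1 + x) N ltac:(lra)).
      rewrite !pow_add.
      simpl pow; field; repeat split; try assumption; lra. }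
  rewrite Htel.
  rewrite sum_n_succ; f_equal; unfold lambert_summand.
  replace (S n + S n)%nat with (S (S (n + n))) by lia.
  replace (S n + 1 + S n)%nat with (n + n + 3)%nat by lia.
  rewrite stirling_rec by exact Hd.
  (* At N = n the recurrence leaves d(2n, n) alone, as d(2n+1, n+1) = 0. *)
  rewrite (proj1 Hd (S (n + n)) (S n)) by lia.
  rewrite <- !tech_pow_Rmult. unfold Rdiv; ring.
Qed.

Lemma Derive_n_realW (d : nat -> nat -> R) (r : R) :
  assoc_stirling1 d ->
  (forall t, Rabs t < r -> ex_derive realW t) ->
  forall n t, Rabs t < r ->
  Derive_n realW (S n) t = sum_n (fun k => lambert_summand d n k (realW t)) n.
Proof.
  intros Hd Hex n; induction n as [|n IH]; intros t Ht;
    destruct (realW_spec t) as [_ [Hpos _]];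
    assert (HW := is_derive_realW t (Hex t Ht)).
  - rewrite sum_O; unfold lambert_summand; simpl Derive_n.
    rewrite stirling_n_0 by exact Hd.
    change (fun x => realW x) with realW.
    rewrite (is_derive_unique _ _ _ HW); simpl; field; lra.
  - rewrite <- lambert_sum_step by assumption.
    simpl Derive_n; apply is_derive_unique.
    apply is_derive_ext_loc with
      (fun y => sum_n (fun k => lambert_summand d n k (realW y)) n).
    { apply filter_imp with (2 := Rabs_lt_locally r t Ht).
      intros y Hy; symmetry; apply IH, Hy. }
    rewrite <- (sum_n_mult_r (K := R_Ring)).
    apply (is_derive_sum_n (fun k y => lambert_summand d n k (realW y))).
    intros k _.
    unfold lambert_summand.
    replace (n + 1 + k)%nat with (S (n + k)) by lia.
    assert (Hc := is_derive_comp (fun y => y / (1 + y) ^ S (n + k)) realW t _ _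
                    (is_derive_div_pow (realW t) (n + k) Hpos) HW).
    apply (is_derive_scal _ _ ((-1) ^ (n + k) * d (n + k)%nat k)) in Hc.
    eapply eq_rect; [exact Hc|].
    match goal with |- ?u = ?v => change (@eq R u v) end.
    change (@scal R_AbsRing R_NormedModule) with Rmult.
    change (@mult R_Ring) with Rmult; ring.
Qed.

(** * The coefficients of the expansion *)

Lemma W_exp_expansion_real (a : nat -> C) :
  W_exp_expansion a ->
  exists r, 0 < r /\ forall t, Rabs t < r ->
    is_series (fun j => Re (a (S j)) * t ^ S j) (realW t - realW 0) /\
    is_series (fun j => Im (a (S j)) * t ^ S j) 0.
Proof.
  intros [r [Hr Hexp]]; exists r; split; [exact Hr|]; intros t Ht.
  destruct (Hexp (RtoC t)) as [s [Hs Heq]]; [rewrite Cmod_R; exact Ht|].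
  rewrite (proj1 (realW_spec t)), omega0_realW in Heq.
  destruct s as [u v]; injection Heq as Hu Hv; simpl in Hu, Hv.
  replace (realW t - realW 0) with u by lra.
  replace 0 with v by lra.
  split.
  - apply is_series_Re in Hs; apply is_series_ext with (2 := Hs).
    intros j; rewrite <- RtoC_pow; apply re_scal_r.
  - apply is_series_Im in Hs; apply is_series_ext with (2 := Hs).
    intros j; rewrite <- RtoC_pow; apply im_scal_r.
Qed.

Lemma is_series_prepend (c : R) (u : nat -> R) (t l : R) :
  is_series (fun j => u (S j) * t ^ S j) l ->
  is_series (fun j => match j with O => c | S _ => u j end * t ^ j) (c + l).
Proof.
  intros H; apply is_series_decr_1.
  change (is_series (fun j => u (S j) * t ^ S j) (c + l + - (c * t ^ 0))).
  replace (c + l + - (c * t ^ 0)) with l by (simpl; ring); exact H.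
Qed.

(** On the real interval the imaginary parts of the coefficients sum to 0, so
    they vanish, and the real parts are the Taylor coefficients of w at 0. *)
Lemma W_exp_coef (d : nat -> nat -> R) (a : nat -> C) (n : nat) :
  assoc_stirling1 d -> W_exp_expansion a ->
  a (S n) = RtoC (sum_n (fun k => lambert_summand d n k (realW 0)) n
                  / INR (fact (S n))).
Proof.
  intros Hd Ha.
  destruct (W_exp_expansion_real a Ha) as [r [Hr Hser]].
  set (b := fun j => match j with O => realW 0 | S _ => Re (a j) end).
  set (c := fun j => match j with O => 0 | S _ => Im (a j) end).
  assert (Hb : forall t, Rabs t < r -> is_series (fun j => b j * t ^ j) (realW t)).
  { intros t Ht; replace (realW t) with (realW 0 + (realW t - realW 0)) by ring.
    apply (is_series_prepend _ (fun j => Re (a j))), Hser, Ht. }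
  assert (Hc : forall t, Rabs t < r -> is_series (fun j => c j * t ^ j) 0).
  { intros t Ht; replace 0 with (0 + 0) by ring.
    apply (is_series_prepend _ (fun j => Im (a j))), Hser, Ht. }
  assert (Hcvb : forall t, Rabs t < r -> Rbar_lt (Rabs t) (CV_radius b)).
  { apply CV_radius_gt_of_disk; intros t Ht; eexists; apply Hb, Ht. }
  assert (Hcvc : forall t, Rabs t < r -> Rbar_lt (Rabs t) (CV_radius c)).
  { apply CV_radius_gt_of_disk; intros t Ht; eexists; apply Hc, Ht. }
  assert (HPb : forall t, Rabs t < r -> PSeries b t = realW t).
  { intros t Ht; apply is_series_unique, Hb, Ht. }
  assert (H0 : Rabs 0 < r) by (rewrite Rabs_R0; exact Hr).
  assert (Him : Im (a (S n)) = 0).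
  { apply (PSeries_locally_zero c r Hr) with (n := S n).
    - rewrite <- Rabs_R0; apply Hcvc, H0.
    - intros t Ht; apply is_series_unique, Hc, Ht. }
  assert (Hex : forall t, Rabs t < r -> ex_derive realW t).
  { intros t Ht; apply ex_derive_ext_loc with (PSeries b).
    - apply filter_imp with (2 := Rabs_lt_locally r t Ht); exact HPb.
    - apply ex_derive_PSeries, Hcvb, Ht. }
  assert (Hre : b (S n) * INR (fact (S n))
            = sum_n (fun k => lambert_summand d n k (realW 0)) n).
  { rewrite <- (Derive_n_realW d r Hd Hex n 0 H0).
    rewrite <- Derive_n_coef by (rewrite <- Rabs_R0; apply Hcvb, H0).
    apply Derive_n_ext_loc, (locally_0_Rabs r); assumption. }
  apply injective_projections; [|exact Him].
  rewrite <- Hre; change (b (S n)) with (Re (a (S n))).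
  simpl fst; unfold Re; field; exact (INR_fact_neq_0 (S n)).
Qed.

Theorem mainTheorem12 :
  forall (d : nat -> nat -> R), assoc_stirling1 d ->
  forall (a : nat -> C), W_exp_expansion a ->
  forall n : nat, (1 <= n)%nat ->
    a n =
      (omega0 / RtoC (INR (fact n)) *
       sum_n (fun k : nat =>
                RtoC ((-1) ^ (n + k - 1) * d (n + k - 1)%nat k) /
                (RtoC 1 + omega0) ^ (n + k))
             (n - 1))%C.
Proof.
  intros d Hd a Ha [|n] Hn; [lia|].
  rewrite (W_exp_coef d a n Hd Ha), omega0_realW.
  destruct (realW_spec 0) as [_ [Hpos _]].
  replace (S n - 1)%nat with n by lia.
  rewrite (sum_n_ext _ (fun k => RtoC ((-1) ^ (n + k) * d (n + k)%nat k
                                        / (1 + realW 0) ^ (n + 1 + k)))).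
  - rewrite sum_n_RtoC, <- RtoC_div, <- RtoC_mult by apply INR_fact_neq_0.
    f_equal.
    rewrite (sum_n_ext _ (fun k => realW 0 * ((-1) ^ (n + k) * d (n + k)%nat k
                                        / (1 + realW 0) ^ (n + 1 + k)))).
    + rewrite sum_n_Rmult_l; unfold Rdiv; ring.
    + intros k; match goal with |- ?u = ?v => change (@eq R u v) end.
      unfold lambert_summand, Rdiv; ring.
  - intros k.
    replace (S n + k - 1)%nat with (n + k)%nat by lia.
    replace (S n + k)%nat with (n + 1 + k)%nat by lia.
    rewrite <- RtoC_plus, <- RtoC_pow, RtoC_div; [reflexivity|].
    apply pow_nonzero; lra.
Qed.
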